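(* Consider a boundary node $(-)$ on an electrically insulating solid wall, with unit outward normal $\vec n$, prescribed wall velocity $\vec v^{\,\mathrm w}$ ($\vec v^{\,\mathrm w}\cdot\vec n=0$), prescribed external magnetic field $\vec B^0$ and prescribed heat entropy flux $g(t)$. Let $(\rho,\vec v,T,\vec B,\psi)^T$ be the primitive state at the node ($\rho>0$, $T>0$) and $\theta_{(\rho)},\theta_{(\vec v)},\theta_{(T)},\theta_{(\vec B)},\theta_{(\psi)}$ the components of the gradient of primitive variables at the node. Define the manufactured ghost state and gradient $$\mathbf v^{\nu,\mathrm{ins}}_{(+)}=\begin{bmatrix}\rho\\ -\vec v+2\vec v^{\,\mathrm w}\\ T\\ -\vec B+2\vec B^0\\ \psi\end{bmatrix},\qquad\boldsymbol\theta^{\mathrm{ins}}_{(+)}=\begin{bmatrix}-\theta_{(\rho)}\\ \theta_{(\vec v)}\\ -\theta_{(T)}+2\kappa^{-1}Tg(t)\vec n\\ \theta_{(\vec B)}\\ -\theta_{(\psi)}\end{bmatrix}.$$ Let $P(t)$ denote the resulting contribution at the node to the time derivative of the discrete entropy of the penalty terms for the diffusive flux together with the penalty on the gradient of the entropy variables, disregarding the interface dissipation operator $\mathrm{DISS}^\nu$ (see context). Then these penalty terms are (i) entropy conservative if the wall is adiabatic: if $g(t)=0$, then $P(t)=0$; (ii) entropy stable in the presence of a heat entropy flux: if $g(t)\neq0$, where $g$ is a given $L^2$ function, then only a bounded amount of discrete entropy is exchanged at the node: for every $t_1>0$, there is a finite constant depending only on $g$ and $t_1$ (not on the numerical solution)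 that bounds $\int_0^{t_1}|P(t)|\,dt$.
   Context: Vectors are row vectors in $\mathbb R^3$. Perfect gas $p=\rho RT$; constants $\mu_{NS},\mu_R,\kappa,\mu_0>0$. Specific entropy $s=\frac R{\gamma-1}\ln(T/T^* )-R\ln(\rho/\rho^* )$ ($T^*,\rho^*$ reference constants); entropy variables $\mathbf w^T=\left(\frac{\gamma R}{\gamma-1}-s-\frac{\|\vec v\|^2}{2T},\frac{\vec v}T,-\frac1T,\frac{\vec B}{\mu_0T},\frac\psi{\mu_0T}\right)$. Gradients: the gradient of primitive variables $\boldsymbol\theta$ has components $\theta_{(\rho)},\theta_{(T)},\theta_{(\psi)}\in\mathbb R^{1\times3}$ and $\theta_{(\vec v)},\theta_{(\vec B)}\in\mathbb R^{3\times3}$, with $(\theta_{(\vec v)})_{ij}$ playing the role of $\partial_{x_j}v_i$, and so on. At the interior node, $\boldsymbol\theta_{(-)}=[\partial\mathbf v/\partial\mathbf w]_{(-)}\mathbf g_{(-)}$, where $\mathbf g_{(-)}$ is the discrete gradient of the entropy variables; at the ghost node, $\mathbf g_{(+)}=[\partial\mathbf w/\partial\mathbf v]_{(+)}\boldsymbol\theta_{(+)}$, with the Jacobian evaluated at the ghost state. Diffusive flux: for a state $\mathbf v$ and primitive gradient $\boldsymbol\theta$ the normal diffusive flux $\mathbf f^\nu$ is the component along $\vec n$ of the flux with rows (density, momentum, energy, magnetic field, $\psi$) $$\vec0;\quad\underline\tau;\quad\vec v\,\underline\tau-\vec q-\tfrac{\mu_R}{\mu_0^2}(\vec\nabla\times\vec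 B)\times\vec B;\quad\tfrac{\mu_R}{\mu_0}\left(\vec\nabla\vec B-(\vec\nabla\vec B)^T\right);\quad\vec0,$$ with $\underline\tau=\mu_{NS}(\vec\nabla\vec v+(\vec\nabla\vec v)^T)-\frac23\mu_{NS}(\vec\nabla\cdot\vec v)\underline I$, $\vec q=-\kappa\vec\nabla T$, where all derivatives are replaced by the corresponding entries of $\boldsymbol\theta$. (Equivalently, the flux in direction $i$ is $\sum_jC^\nu_{ij}(\mathbf u)\mathbf g_j$, with $\mathbf g_j$ the $j$-th component of the entropy-variable gradient.) Write $\mathbf f^\nu_{(-)}$, $\mathbf f^\nu_{(+)}$ for the normal diffusive fluxes of the interior and ghost states and gradients, and $\mathbf w_{(\pm)}$ for their entropy variables. Entropy contribution: with the BR1 averages $\hat{\mathbf w}=\frac12(\mathbf w_{(-)}+\mathbf w_{(+)})$ and $\hat{\mathbf f}^\nu=\frac12(\mathbf f^\nu_{(-)}+\mathbf f^\nu_{(+)})$, the penalty terms (on the diffusive flux and on the gradient of the entropy variables), without $\mathrm{DISS}^\nu$, contribute to the time derivative of the discrete entropy at the boundary node $$P=(\hat{\mathbf w}-\mathbf w_{(-)})^T\mathbf f^\nu_{(-)}+\mathbf w_{(-)}^T\hat{\mathbf f}^\nu=\tfrac12\left(\mathbf w_{(+)}^T\mathbf f^\nu_{(-)}+\mathbf w_{(-)}^T\mathbf f^\nu_{(+)}\right).$$ ''Entropy conservative'' means $P=0$; ''entropy stable'' means that the entropy contributed at the node is bounded by the prescribed data. *)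

(* Defs.v *)
From HB Require Import structures.
From mathcomp Require Import all_boot all_order all_algebra.
From mathcomp Require Import all_classical all_reals all_analysis.

Set Implicit Arguments.
Unset Strict Implicit.
Unset Printing Implicit Defensive.

Import Order.TTheory GRing.Theory Num.Theory.
Import numFieldNormedType.Exports.

Local Open Scope ring_scope.

Section Vectors.
Variable R : realType.

(* The norm `|u| of the library on 'rV_3 is the sup norm; Euclidean norms are
   expressed through dotv. *)
Definition dotv (u v : 'rV[R]_3) : R := (u *m v^T) 0 0.

Definition vec3 (a b c : R) : 'rV[R]_3 := \row_(i < 3) [:: a; b; c]`_i.

Definition crossv (u v : 'rV[R]_3) : 'rV[R]_3 :=
  let e := fun (w : 'rV[R]_3) (i : nat) => w 0 (inord i) in
  vec3 (e u 1%N * e v 2%N - e u 2%N * e v 1%N)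
       (e u 2%N * e v 0%N - e u 0%N * e v 2%N)
       (e u 0%N * e v 1%N - e u 1%N * e v 0%N).

(* In a gradient matrix G, entry G i j stands for d u_i / d x_j. *)
Definition curlv (G : 'M[R]_3) : 'rV[R]_3 :=
  let d := fun i j : nat => G (inord i) (inord j) in
  vec3 (d 2%N 1%N - d 1%N 2%N)
       (d 0%N 2%N - d 2%N 0%N)
       (d 1%N 0%N - d 0%N 1%N).

End Vectors.

Section ResistiveMHD.
Variable R : realType.

Record mhd_constants := MHDConstants {
  gasR : R;
  gamma : R;
  T_ref : R;
  rho_ref : R;
  mu_NS : R;
  mu_R : R;
  kappa : R;
  mu_0 : R;
  gasR_gt0 : 0 < gasR;
  gamma_gt1 : 1 < gamma;
  T_ref_gt0 : 0 < T_ref;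
  rho_ref_gt0 : 0 < rho_ref;
  mu_NS_gt0 : 0 < mu_NS;
  mu_R_gt0 : 0 < mu_R;
  kappa_gt0 : 0 < kappa;
  mu_0_gt0 : 0 < mu_0
}.

Record prim := Prim {
  dens : R;
  vel : 'rV[R]_3;
  temp : R;
  mag : 'rV[R]_3;
  psi : R
}.

Record prim_grad := PrimGrad {
  grad_dens : 'rV[R]_3;
  grad_vel : 'M[R]_3;
  grad_temp : 'rV[R]_3;
  grad_mag : 'M[R]_3;
  grad_psi : 'rV[R]_3
}.

(* Component blocks of the conservative variables: density, momentum, energy,
   magnetic field, psi. *)
Definition nvars := (1 + (3 + (1 + (3 + 1))))%N.

Definition stack m (a : 'M[R]_(1, m)) (b : 'M[R]_(3, m)) (c : 'M[R]_(1, m))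
    (d : 'M[R]_(3, m)) (e : 'M[R]_(1, m)) : 'M[R]_(nvars, m) :=
  col_mx a (col_mx b (col_mx c (col_mx d e))).

Variable c : mhd_constants.

Definition specific_entropy (u : prim) : R :=
  gasR c / (gamma c - 1) * ln (temp u / T_ref c)
  - gasR c * ln (dens u / rho_ref c).

Definition entropy_vars (u : prim) : 'cV[R]_nvars :=
  stack
    (gamma c * gasR c / (gamma c - 1) - specific_entropy u
       - dotv (vel u) (vel u) / (2 * temp u))%:M
    ((temp u)^-1 *: vel u)^T
    (- (temp u)^-1)%:M
    ((mu_0 c * temp u)^-1 *: mag u)^T
    (psi u / (mu_0 c * temp u))%:M.

Definition stress (th : prim_grad) : 'M[R]_3 :=
  mu_NS c *: (grad_vel th + (grad_vel th)^T)
  - (2 / 3 * mu_NS c * \tr (grad_vel th))%:M.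

Definition heat_flux (th : prim_grad) : 'rV[R]_3 := - kappa c *: grad_temp th.

(* Column j is the flux in direction x_j. *)
Definition diffusive_flux (u : prim) (th : prim_grad) : 'M[R]_(nvars, 3) :=
  stack
    0
    (stress th)
    (vel u *m stress th - heat_flux th
       - (mu_R c / mu_0 c ^+ 2) *: crossv (curlv (grad_mag th)) (mag u))
    ((mu_R c / mu_0 c) *: (grad_mag th - (grad_mag th)^T))
    0.

Definition normal_diffusive_flux (n : 'rV[R]_3) (u : prim) (th : prim_grad) :
    'cV[R]_nvars :=
  diffusive_flux u th *m n^T.

(* Contribution of the BR1 penalties, on the diffusive flux and on the gradient
   of the entropy variables, to the rate of change of the discrete entropy at a
   boundary node with interior data (um, thm) and ghost data (up, thp). *)
Definition penalty_entropy (n : 'rV[R]_3) (um up : prim) (thm thp : prim_grad) :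
    R :=
  let wm := entropy_vars um in
  let wp := entropy_vars up in
  let fm := normal_diffusive_flux n um thm in
  let fp := normal_diffusive_flux n up thp in
  let what := 2^-1 *: (wm + wp) in
  let fhat := 2^-1 *: (fm + fp) in
  ((what - wm)^T *m fm + wm^T *m fhat) 0 0.

Definition ghost_ins (vw B0 : 'rV[R]_3) (u : prim) : prim :=
  Prim (dens u) (- vel u + 2 *: vw) (temp u) (- mag u + 2 *: B0) (psi u).

Definition ghost_grad_ins (n : 'rV[R]_3) (g : R) (u : prim) (th : prim_grad) :
    prim_grad :=
  PrimGrad (- grad_dens th) (grad_vel th)
    (- grad_temp th + (2 * (kappa c)^-1 * temp u * g) *: n)
    (grad_mag th) (- grad_psi th).

Definition wall_entropy (n vw B0 : 'rV[R]_3) (g : R) (u : prim)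
    (th : prim_grad) : R :=
  penalty_entropy n u (ghost_ins vw B0 u) th (ghost_grad_ins n g u th).

Definition wall_node (n vw : 'rV[R]_3) (u : prim) : Prop :=
  [/\ dotv n n = 1, dotv vw n = 0, 0 < dens u & 0 < temp u].

End ResistiveMHD.

(* Main.v *)
(** The pairing of entropy variables with a normal diffusive flux is 1/T times
    stress work, heat flux and resistive work, where the two resistive
    contributions combine through (G - G^T) n = curl G x n. The wall state keeps
    T, the velocity gradient and the curl of B, so in the symmetric sum over
    interior and ghost data the stress and resistive terms, being antisymmetric
    in the two states, cancel. What remains is the mean heat flux over T, which
    is -g; and an L^2 function is integrable on a bounded interval. *)
Require Import Defs.
From mathcomp Require Import all_boot all_order all_algebra.
From mathcomp Require Import all_classical all_reals all_analysis.
From mathcomp Require Import ring lra.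

Set Implicit Arguments.
Unset Strict Implicit.
Unset Printing Implicit Defensive.

Import Order.TTheory GRing.Theory Num.Theory.
Import numFieldNormedType.Exports.

Local Open Scope classical_set_scope.
Local Open Scope ring_scope.

Lemma dotvDl (R : realType) (u v w : 'rV[R]_3) :
  dotv (u + v) w = dotv u w + dotv v w.
Proof. by rewrite /dotv mulmxDl mxE. Qed.

Lemma dotvZl (R : realType) (a : R) (u v : 'rV[R]_3) :
  dotv (a *: u) v = a * dotv u v.
Proof. by rewrite /dotv -scalemxAl mxE. Qed.

Lemma dotvNl (R : realType) (u v : 'rV[R]_3) : dotv (- u) v = - dotv u v.
Proof. by rewrite /dotv mulNmx mxE. Qed.

Lemma crossvBr (R : realType) (u v w : 'rV[R]_3) :
  crossv u (v - w) = crossv u v - crossv u w.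
Proof.
by apply/rowP => -[[|[|[|//]]] ?]; rewrite !mxE /=; ring.
Qed.

(** The skew part acts as a cross product, [(G - G^T) n = curl G x n]; the sign comes from
    exchanging [b] and [n] in the triple product. *)
Lemma skew_curlv (R : realType) (G : 'M[R]_3) (b n : 'rV[R]_3) :
  (b *m (G - G^T) *m n^T) 0 0 = - dotv (crossv (curlv G) b) n.
Proof.
rewrite /dotv !mxE !big_ord_recl !big_ord0 !mxE !big_ord_recl !big_ord0 !mxE.
(* Expanding the sums yields [lift] indices, while [crossv] and [curlv] use [inord]; [ring] needs a
   single form. *)
have -> : lift ord0 (lift ord0 ord0) = inord 2 :> 'I_3.
  by apply/val_inj; rewrite /= inordK.
have -> : lift ord0 ord0 = inord 1 :> 'I_3.
  by apply/val_inj; rewrite /= inordK.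
have -> : ord0 = inord 0 :> 'I_3.
  by apply/val_inj; rewrite /= inordK.
rewrite !inordK //=; ring.
Qed.

Lemma mul_tr_stack (R : realType) (a1 : 'M[R]_1) (b1 : 'cV[R]_3)
    (c1 : 'M[R]_1) (d1 : 'cV[R]_3) (e1 a2 : 'M[R]_1) (b2 : 'cV[R]_3)
    (c2 : 'M[R]_1) (d2 : 'cV[R]_3) (e2 : 'M[R]_1) :
  (stack a1 b1 c1 d1 e1)^T *m stack a2 b2 c2 d2 e2 =
  a1^T *m a2 + (b1^T *m b2 + (c1^T *m c2 + (d1^T *m d2 + e1^T *m e2))).
Proof. by rewrite /stack !tr_col_mx !mul_row_col. Qed.

Lemma mul_stack (R : realType) m k (a : 'M[R]_(1, m)) (b : 'M[R]_(3, m))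
    (c : 'M[R]_(1, m)) (d : 'M[R]_(3, m)) (e : 'M[R]_(1, m))
    (A : 'M[R]_(m, k)) :
  stack a b c d e *m A =
  stack (a *m A) (b *m A) (c *m A) (d *m A) (e *m A).
Proof. by rewrite /stack !mul_col_mx. Qed.

(** The states [w] and [u] stay independent because the penalty pairs each side's entropy variables
    with the other side's flux. The zero density and psi rows remove the logarithmic entropy
    variable. The energy entry [-1/T] supplies the terms in [u]; the momentum and magnetic rows
    supply those in [w]. *)
Lemma entropy_vars_flux (R : realType) (c : mhd_constants R) (n : 'rV[R]_3)
    (w u : prim R) (th : prim_grad R) :
  temp w != 0 ->
  ((entropy_vars c w)^T *m normal_diffusive_flux c n u th) 0 0 =
  (temp w)^-1 *
    (((vel w - vel u) *m stress c th *m n^T) 0 0 + dotv (heat_flux c th) n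
     + mu_R c / mu_0 c ^+ 2
       * dotv (crossv (curlv (grad_mag th)) (mag u - mag w)) n).
Proof.
move=> T0; have m0 : mu_0 c != 0 by rewrite gt_eqF // mu_0_gt0.
rewrite /normal_diffusive_flux /diffusive_flux /entropy_vars mul_stack.
rewrite mul_tr_stack !mul0mx !mulmx0 add0r addr0 !trmxK tr_scalar_mx.
rewrite mul_scalar_mx -!scalemxAl -scalemxAr !mulmxA.
have addE (A B : 'M[R]_1) : (A + B) 0 0 = A 0 0 + B 0 0 by rewrite mxE.
have scaleE a (A : 'M[R]_1) : (a *: A) 0 0 = a * A 0 0 by rewrite mxE.
have oppE (A : 'M[R]_1) : (- A) 0 0 = - A 0 0 by rewrite mxE.
(* Generalizing hides the scaling inside the heat flux from the rewrites below. *)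
move: (heat_flux c th) => q.
rewrite !addE !scaleE skew_curlv !mulmxBl -scalemxAl !addE !oppE scaleE.
rewrite crossvBr dotvDl dotvNl /dotv.
by field; rewrite T0 m0.
Qed.

(** The two normal heat fluxes add up to [-2 T g]: the ghost gradient flips [grad_temp], and its
    factor [2 T / kappa] is matched to the weight [1 / (2 T)] of the pairing. *)
Lemma wall_entropyE (R : realType) (c : mhd_constants R) (n vw B0 : 'rV[R]_3)
    (g : R) (u : prim R) (th : prim_grad R) :
  dotv n n = 1 -> temp u != 0 -> wall_entropy c n vw B0 g u th = - g.
Proof.
move=> n1 T0; have k0 : kappa c != 0 by rewrite gt_eqF // kappa_gt0.
have m0 : mu_0 c != 0 by rewrite gt_eqF // mu_0_gt0.
rewrite /wall_entropy /penalty_entropy.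
set wm := entropy_vars c u; set wp := entropy_vars c _.
set fm := normal_diffusive_flux c n u th.
set fp := normal_diffusive_flux c n _ _.
(* The pairing of [wm] with [fm] cancels, leaving only the two mixed pairings. *)
have -> : (2^-1 *: (wm + wp) - wm)^T *m fm + wm^T *m (2^-1 *: (fm + fp)) =
    2^-1 *: (wp^T *m fm + wm^T *m fp).
  have -> : 2^-1 *: (wm + wp) - wm = 2^-1 *: (wp - wm).
    by apply/matrixP => i j; rewrite !mxE; field.
  rewrite linearZ linearB /= -scalemxAl -scalemxAr -scalerDr mulmxBl mulmxDr.
  by rewrite addrA subrK.
rewrite 2!mxE !entropy_vars_flux //=.
have -> : stress c (ghost_grad_ins c n g u th) = stress c th by [].
have oppE (A : 'M[R]_1) : (- A) 0 0 = - A 0 0 by rewrite mxE.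
(* Both pairings now use the differences ghost minus interior, so opposite terms match
   syntactically. *)
rewrite -[vel u - _]opprB mulNmx mulNmx oppE -[mag u - _]opprB.
have crossN (a b : 'rV[R]_3) : crossv a (- b) = - crossv a b.
  by rewrite -sub0r crossvBr -[in crossv a 0](subrr 0) crossvBr subrr sub0r.
rewrite crossN dotvNl /heat_flux /= !dotvZl dotvDl dotvNl dotvZl n1.
by field; rewrite m0 k0 T0.
Qed.

(** On a set of finite measure, [1 + f ^+ 2] is an integrable majorant of [f]. *)
Lemma Lfun2_integrable (d : measure_display) (T : measurableType d)
    (R : realType) (mu : {measure set T -> \bar R}) (D : set T) (f : T -> R) :
  measurable D -> (mu D < +oo)%E -> f \in Lfun mu 2%:E ->
  mu.-integrable D (EFin \o f).
Proof.
move=> mD muD f2.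
have mf : measurable_fun D f.
  apply: measurable_funTS; have /andP[/= mf _] := f2.
  by rewrite inE in mf.
apply: (@le_integrable _ _ _ mu D mD _ (fun x => 1%:E + (f x ^+ 2)%:E)%E).
- exact/measurable_realfun.measurable_EFinP.
- move=> x _; rewrite lee_fin /= [leRHS]ger0_norm ?addr_ge0 ?sqr_ge0 //.
  rewrite -real_normK ?num_real //.
  (* The square gives [2 |f| <= 1 + f ^+ 2], and the sign of [|f|] lets the factor 2 be dropped. *)
  have := sqr_ge0 (`|f x| - 1); have := normr_ge0 (f x); nra.
- apply: integrableD => //.
    by apply: measurable_bounded_integrable => //; exact: bounded_cst.
  exact: integrableS (Lfun2_integrable_sqr f2) => //.
Qed.

Theorem theorem5 (R : realType) (g : R -> R) :
  (forall (c : mhd_constants R) (n : 'rV[R]_3) (vw B0 : R -> 'rV[R]_3)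
      (u : R -> prim R) (th : R -> prim_grad R) (t : R),
    wall_node n (vw t) (u t) -> g t = 0 ->
    wall_entropy c n (vw t) (B0 t) (g t) (u t) (th t) = 0) /\
  ((exists t : R, g t <> 0) ->
   forall t1 : R, 0 < t1 ->
   g \_ `[0, t1] \in Lfun (@lebesgue_measure R) 2%:E ->
   exists C : R,
   forall (c : mhd_constants R) (n : 'rV[R]_3) (vw B0 : R -> 'rV[R]_3)
      (u : R -> prim R) (th : R -> prim_grad R),
    (forall t, 0 <= t <= t1 -> wall_node n (vw t) (u t)) ->
    let P := fun t =>
      wall_entropy c n (vw t) (B0 t) (g t) (u t) (th t) in
    (@lebesgue_measure R).-integrable `[0, t1] (EFin \o P) /\
    (\int[@lebesgue_measure R]_(t in `[0%R, t1]) (`|P t|%R)%:E <= C%:E)%E).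
Proof.
split=> [c n vw B0 u th t [n1 _ _ T0] g0|_ t1 t1_gt0 g2].
  by rewrite wall_entropyE ?gt_eqF // g0 oppr0.
have ig : (@lebesgue_measure R).-integrable `[0, t1] (EFin \o g).
  (* The L^2 hypothesis concerns [g] extended by zero outside the interval; both functions agree on
     it. *)
  apply: (@eq_integrable _ _ _ (@lebesgue_measure R) _ _ (EFin \o (g \_ `[0, t1]))) => //.
    by move=> t t01; rewrite /= patchE t01.
  apply: Lfun2_integrable g2 => //.
  by rewrite /= lebesgue_measure_itv /= lte_fin t1_gt0 -EFinB ltry.
(* The L^1 norm of [g] on the interval, fixed before the constants, the wall data and the solution
   are introduced. *)
exists (fine (\int[@lebesgue_measure R]_(t in `[0%R, t1]) `|(g t)%:E|)%E).
move=> c n vw B0 u th wall P.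
have PE t : t \in `[0, t1]%classic -> P t = - g t.
  rewrite inE /= in_itv /= => /wall[n1 _ _ T0].
  by rewrite /P wall_entropyE ?gt_eqF.
(* The state and gradient are arbitrary functions of time; [P] inherits integrability from [g] by
   agreeing with [- g] on the interval. *)
split.
  apply: (@eq_integrable _ _ _ (@lebesgue_measure R) _ _ (-%E \o (EFin \o g))) => //.
    by move=> t /PE /= ->.
  exact: integrableN.
(* Integrability makes the norm finite, so [fine] loses nothing; the bound is then an equality. *)
rewrite fineK; last first.
  by apply: integrable_fin_num => //; exact: integrable_abse ig.
rewrite le_eqVlt; apply/orP; left; apply/eqP.
by apply: eq_integral => t /PE ->; rewrite normrN.
Qed.
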